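(* Let $A$ be a unital algebraic (not necessarily associative) algebra over a field $F$ of characteristic zero and let $R$ be a Rota--Baxter operator of weight $\lambda$ on $A$. Then the limiting derived algebra $A_\infty$ is well-defined. Moreover: (a) If $\lambda=0$, then $A_\infty$ has trivial (zero) product. (b) If $\lambda\neq0$, then $A_\infty\cong\ker(R^n)\oplus\ker((R+\lambda\,\mathrm{id})^n)$ for all sufficiently large $n$.
   Context: An algebra over $F$ is an $F$-vector space with a bilinear product, not assumed associative or commutative; unital means having a two-sided identity $1$. A linear operator $R\colon A\to A$ is a Rota--Baxter operator of weight $\lambda\in F$ if $R(x)R(y)=R(R(x)y+xR(y)+\lambda xy)$ for all $x,y\in A$. An associative algebra is algebraic if each of its elements is a root of a nonzero polynomial over $F$; in the nonassociative case, an algebra is algebraic if every finite subset generates a finite-dimensional subalgebra. The derived algebras $A_i$, $i\ge0$, are defined on the underlying vector space of $A$ with products $\circ_i$ given by $x\circ_0y=xy$ and $x\circ_{i+1}y=R(x)\circ_iy+x\circ_iR(y)+\lambda\,x\circ_iy$. If there exists a minimal natural number $m$ such that $A_n\cong A_m$ (as algebras) for all $n>m$, the limiting derived algebra is $A_\infty:=A_m$; otherwise $A_\infty$ is not defined. In (b), $\ker(R^n)$ and $\ker((R+\lambda\,\mathrm{id})^n)$ are subalgebras of $A$, and $\oplus$ denotes the direct sum of algebras (products between the two summands are zero). *)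

(* Defs.v *)
From HB Require Import structures.
From mathcomp Require Import all_boot all_order all_algebra.
Set Implicit Arguments.
Unset Strict Implicit.
Unset Printing Implicit Defensive.
Import GRing.Theory.
Local Open Scope ring_scope.

(* The structures of the algebra hierarchy are all associative, hence this    *)
(* record for arbitrary, possibly infinite-dimensional algebras.               *)
Record algebra (F : fieldType) := Algebra {
  avect :> lmodType F;
  amul : avect -> avect -> avect;
  amulP : bilinear_for *:%R *:%R amul }.

HB.instance Definition _ (F : fieldType) (A : algebra F) :=
  bilinear_isBilinear.Build F A A A *:%R *:%R (@amul F A) (amulP A).

Declare Scope alg_scope.
Open Scope alg_scope.
Notation "x ∙ y" := (amul x y) (at level 40, left associativity) : alg_scope.

Section Algebras.
Variable F : fieldType.
Implicit Types A B : algebra F.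

Definition is_identity A (e : A) : Prop := forall x : A, e ∙ x = x /\ x ∙ e = x.

Definition associative_alg A : Prop := associative (@amul F A).

Definition zero_product A : Prop := forall x y : A, x ∙ y = 0.

Definition alg_iso A B : Prop :=
  exists f : {linear A -> B}, bijective f /\ {morph f : x y / x ∙ y}.

(* a ^ k, bracketed to the right, with a ^ 0 = e *)
Definition apow A (e a : A) (k : nat) : A := iter k (amul a) e.

Definition algebraic_elt A (e a : A) : Prop :=
  exists2 p : {poly F}, p != 0 & \sum_(k < size p) p`_k *: apow e a k = 0.

Inductive generated A (S : seq A) : A -> Prop :=
| Gen_mem x of x \in S : generated S x
| Gen_0 : generated S 0
| Gen_D x y of generated S x & generated S y : generated S (x + y)
| Gen_Z (c : F) x of generated S x : generated S (c *: x)
| Gen_M x y of generated S x & generated S y : generated S (x ∙ y).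

Definition locally_finite A : Prop :=
  forall S : seq A, exists (d : nat) (b : 'I_d -> A),
    (forall i, generated S (b i)) /\
    (forall x, generated S x -> exists c : 'I_d -> F, x = \sum_i c i *: b i).

(* In an associative algebra, elementwise algebraicity is strictly weaker than *)
(* local finiteness, so the two cases are kept apart; a locally finite unital  *)
(* algebra satisfies this predicate whether or not it is associative.          *)
Definition algebraic A (e : A) : Prop :=
  (associative_alg A -> forall a : A, algebraic_elt e a) /\
  (~ associative_alg A -> locally_finite A).

Definition rota_baxter A (lam : F) (R : {linear A -> A}) : Prop :=
  forall x y : A, R x ∙ R y = R (R x ∙ y + x ∙ R y + lam *: (x ∙ y)).

End Algebras.

Section Derived.
Variables (F : fieldType) (A : algebra F) (lam : F) (R : {linear A -> A}).

Fixpoint derived_mul (i : nat) (x y : A) : A :=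
  if i is j.+1 then
    derived_mul j (R x) y + derived_mul j x (R y) + lam *: derived_mul j x y
  else x ∙ y.

Lemma derived_mulP i : bilinear_for *:%R *:%R (derived_mul i).
Proof.
elim: i => [|i [IHl IHr]]; first exact: amulP.
split=> u a x y /=; rewrite linearP.
  have H v : derived_mul i (a *: x + y) v
      = a *: derived_mul i x v + derived_mul i y v by exact: IHl.
  have H1 v : derived_mul i (a *: R x + R y) v
      = a *: derived_mul i (R x) v + derived_mul i (R y) v by exact: IHl.
  rewrite H1 !H !scalerDr !scalerA [a * lam]mulrC.
  by rewrite [X in X + _ = _]addrACA [LHS]addrACA.
rewrite !IHr !scalerDr !scalerA [a * lam]mulrC.
by rewrite [X in X + _ = _]addrACA [LHS]addrACA.
Qed.

Definition derived_alg (i : nat) : algebra F := Algebra (derived_mulP i).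

Definition stable_from (m : nat) : Prop :=
  forall n, (m < n)%N -> alg_iso (derived_alg n) (derived_alg m).

(* The limiting derived algebra is derived_alg m for the (necessarily unique)  *)
(* m satisfying this predicate, and is undefined if there is none.             *)
Definition limiting_index (m : nat) : Prop :=
  stable_from m /\ (forall k, stable_from k -> (m <= k)%N).

End Derived.

Section Subalgebra.
Variables (F : fieldType) (A : algebra F) (S : submodClosed A).
Hypothesis mulS : forall x y : A, x \in S -> y \in S -> x ∙ y \in S.

Definition sub_carrier : Type := {x : A | x \in S}.
HB.instance Definition _ := SubType.copy sub_carrier {x : A | x \in S}.
HB.instance Definition _ := [Choice of sub_carrier by <:].
HB.instance Definition _ := [SubChoice_isSubLmodule of sub_carrier by <:].

Definition sub_mul (x y : sub_carrier) : sub_carrier :=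
  Sub (val x ∙ val y) (mulS (valP x) (valP y)).

Lemma sub_mulP : bilinear_for *:%R *:%R sub_mul.
Proof.
by split=> u a x y; apply: val_inj; rewrite linearP /= ?linearPl ?linearPr.
Qed.

Definition subalg : algebra F := Algebra sub_mulP.

End Subalgebra.

Section DirectSum.
Variables (F : fieldType) (A B : algebra F).

Definition dsum_mul (x y : (A * B)%type) : (A * B)%type :=
  (x.1 ∙ y.1, x.2 ∙ y.2).

Lemma dsum_mulP : bilinear_for *:%R *:%R dsum_mul.
Proof.
split=> u a x y; rewrite /dsum_mul /=; congr pair; rewrite ?linearPl ?linearPr //.
Qed.

Definition dsum : algebra F := Algebra dsum_mulP.

End DirectSum.

Section Kernels.
Variables (F : fieldType) (A : algebra F).

(* ker (f ^ n) *)
Definition iker (f : {linear A -> A}) (n : nat) : {pred A} :=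
  [pred x | iter n f x == 0].

Lemma iker_submod f n : submod_closed (iker f n).
Proof.
have lin a x y : iter n f (a *: x + y) = a *: iter n f x + iter n f y.
  by elim: n => //= n ->; rewrite linearP.
have it0 : iter n f 0 = 0 by elim: n {lin} => //= n ->; rewrite linear0.
split=> [|a x y]; rewrite !inE ?it0 // => /eqP x0 /eqP y0.
by rewrite lin x0 y0 scaler0 addr0.
Qed.

HB.instance Definition _ f n :=
  GRing.isSubmodClosed.Build F A (iker f n) (iker_submod f n).

(* If P and Q = P + mu id, mu != 0, both turn each derived product into the    *)
(* previous one, then ker (P ^ n) is closed under the product of A.            *)
Lemma iker_mul (lam mu : F) (R P Q : {linear A -> A}) :
    mu != 0 -> (forall x, Q x = P x + mu *: x) ->
    (forall i x y, P (derived_mul lam R i.+1 x y)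
       = derived_mul lam R i (P x) (P y)) ->
    (forall i x y, Q (derived_mul lam R i.+1 x y)
       = derived_mul lam R i (Q x) (Q y)) ->
  forall n x y, x \in iker P n -> y \in iker P n -> x ∙ y \in iker P n.
Proof.
move=> mu0 QE PM QM n.
have itM (T : {linear A -> A}) k x y :
    (forall i x y, T (derived_mul lam R i.+1 x y)
       = derived_mul lam R i (T x) (T y)) ->
    iter k T (derived_mul lam R k x y) = iter k T x ∙ iter k T y.
  by move=> TM; elim: k x y => // k IH x y; rewrite iterSr TM IH -!iterSr.
have surj1 k x : iter k P x = 0 -> exists2 z, iter k P z = 0 & Q z = x.
  elim: k x => [|k IH] x; first by move=> /= ->; exists 0; rewrite ?linear0.
  rewrite iterSr => Px; have [z Pz Qz] := IH _ Px.
  exists (mu^-1 *: (x - z)); last first.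
    by rewrite linearZ linearB Qz QE addrC addKr /= scalerA mulVf ?scale1r.
  apply/eqP; rewrite -[_ == 0]/(_ \in iker P k.+1) rpredZ // rpredB //.
    by rewrite inE iterSr Px.
  by rewrite inE /= Pz linear0.
have surj k x : iter n P x = 0 -> exists2 z, iter n P z = 0 & iter k Q z = x.
  elim: k x => [|k IH] x Px; first by exists x.
  have [z Pz Qz] := surj1 _ _ Px; have [w Pw Qw] := IH _ Pz.
  by exists w; rewrite //= Qw.
move=> x y /eqP/(surj n)[x' Px <-] /eqP/(surj n)[y' Py <-].
have comm k z : iter k P (Q z) = Q (iter k P z).
  by elim: k => //= k ->; rewrite !QE linearD linearZ.
have comm' j k z : iter k P (iter j Q z) = iter j Q (iter k P z).
  by elim: j => //= j <-; rewrite comm.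
have it0 k : iter k Q 0 = 0 by elim: k => //= k ->; rewrite linear0.
by rewrite inE -itM // comm' itM // Px linear0l it0.
Qed.

Variables (lam : F) (R : {linear A -> A}).

Definition shift_op : {linear A -> A} := R \+ lam \*: idfun.

Lemma shift_opE x : shift_op x = R x + lam *: x. Proof. by []. Qed.

Hypothesis rbR : rota_baxter lam R.

Lemma rb_derived i x y :
  R (derived_mul lam R i.+1 x y) = derived_mul lam R i (R x) (R y).
Proof.
elim: i x y => [|i IH] x y; first by rewrite [RHS]rbR.
rewrite -[derived_mul _ _ i.+2 x y]/(derived_mul lam R i.+1 (R x) y
  + derived_mul lam R i.+1 x (R y) + lam *: derived_mul lam R i.+1 x y).
by rewrite linearD linearD linearZ !IH.
Qed.

Lemma shift_derived i x y :
  shift_op (derived_mul lam R i.+1 x y)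
  = derived_mul lam R i (shift_op x) (shift_op y).
Proof.
have [Hl Hr] := derived_mulP lam R i.
have El v : derived_mul lam R i (R x + lam *: x) v
    = derived_mul lam R i (R x) v + lam *: derived_mul lam R i x v.
  by rewrite addrC [RHS]addrC; apply: Hl.
have Er u : derived_mul lam R i u (R y + lam *: y)
    = derived_mul lam R i u (R y) + lam *: derived_mul lam R i u y.
  by rewrite addrC [RHS]addrC; apply: Hr.
rewrite !shift_opE rb_derived El !Er /= !scalerDr -!addrA.
by congr (_ + _); rewrite addrCA.
Qed.

Hypothesis lam0 : lam != 0.

Lemma kerR_mul n x y : x \in iker R n -> y \in iker R n -> x ∙ y \in iker R n.
Proof. exact: (iker_mul lam0 shift_opE rb_derived shift_derived). Qed.

Lemma kerRlam_mul n x y :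
  x \in iker shift_op n -> y \in iker shift_op n -> x ∙ y \in iker shift_op n.
Proof.
have mu0 : - lam != 0 by rewrite oppr_eq0.
apply: (iker_mul mu0 _ shift_derived rb_derived) => z.
by rewrite shift_opE scaleNr addrK.
Qed.

(* the subalgebras ker (R ^ n) and ker ((R + lam id) ^ n) *)
Definition kerR_alg n : algebra F := subalg (@kerR_mul n).
Definition kerRlam_alg n : algebra F := subalg (@kerRlam_mul n).

End Kernels.

(* Main.v *)
From HB Require Import structures.
Require Import Defs.
From mathcomp Require Import all_boot all_order all_algebra.
From mathcomp Require Import ring.
From Stdlib Require Import Classical_Prop.
Set Implicit Arguments.
Unset Strict Implicit.
Unset Printing Implicit Defensive.
Import GRing.Theory.
Local Open Scope ring_scope.

(* Let Q = R + lam id, a = R(1), and let L_x be left multiplication by x. The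
   Rota-Baxter identity gives [L_a, R] = R Q, so p(R)1 = 0 implies
   (R Q p'(R))1 = 0. As a is algebraic, p(R)1 = 0 for some p != 0, and
   differentiating (char F = 0) until p is constant gives R^i Q^j 1 = 0 for
   some i and j. Next, [L_{Rx}, R] = R L_x Q and [L_{Qx}, R] = Q L_x R allow
   the factors of R^i Q^j to be peeled off L_{R^i Q^j 1} = 0, down to L_1 = id
   sandwiched between monomials in R and Q; hence R^N Q^N = 0 on A. If
   lam = 0, R is nilpotent and the derived products vanish eventually. If
   lam != 0, A is the sum of the kernels of R^n and Q^n (n >= N), and
   x |-> (Q^n x, R^n x) is an isomorphism from A_n to their direct sum. *)

Lemma coef_neq0_lt_size (R : nzSemiRingType) (p : {poly R}) n :
  p`_n != 0 -> (n < size p)%N.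
Proof. by apply: contraNT; rewrite -leqNgt => /leq_sizeP->. Qed.

(** * Evaluation of polynomials at a linear operator *)

Section OperatorPolynomial.
Variables (F : fieldType) (V : lmodType F) (f : {linear V -> V}).
Implicit Types (p q : {poly F}) (x y : V).

(** When [f] is left multiplication by [a], this unfolds to the very sum that occurs in
    [algebraic_elt]. *)
Definition op_horner p x : V := \sum_(i < size p) p`_i *: iter i f x.

Lemma iter_linear n : linear (iter n f).
Proof. by elim: n => // n IH a x y; rewrite /= IH linearP. Qed.

(** Coefficients beyond the size vanish, so polynomials of different sizes can be summed over one
    common range. *)
Lemma op_horner_widen n p x :
  (size p <= n)%N -> op_horner p x = \sum_(i < n) p`_i *: iter i f x.
Proof.
move=> le_pn; rewrite /op_horner.
rewrite (big_ord_widen n (fun i => p`_i *: iter i f x)) // big_mkcond /=.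
apply: eq_bigr => i _; case: ltnP => // /(nth_default 0) ->.
by rewrite scale0r.
Qed.

Lemma op_hornerPl x : linear (op_horner ^~ x).
Proof.
move=> a p q /=; pose n := maxn (size (a *: p + q)) (maxn (size p) (size q)).
rewrite !(@op_horner_widen n) ?leq_max ?leqnn ?orbT //.
rewrite scaler_sumr -big_split; apply: eq_bigr => i _ /=.
by rewrite coefD coefZ scalerDl scalerA.
Qed.

Lemma op_hornerPr p : linear (op_horner p).
Proof.
move=> a x y; rewrite /op_horner scaler_sumr -big_split.
apply: eq_bigr => i _ /=.
by rewrite iter_linear scalerDr !scalerA mulrC.
Qed.

HB.instance Definition _ p :=
  GRing.isLinear.Build F V V *:%R (op_horner p) (op_hornerPr p).

Lemma op_horner0 x : op_horner 0 x = 0.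
Proof. by rewrite /op_horner size_poly0 big_ord0. Qed.

Lemma op_hornerD p q x : op_horner (p + q) x = op_horner p x + op_horner q x.
Proof. by rewrite -[p]scale1r op_hornerPl !scale1r. Qed.

Lemma op_hornerZ a p x : op_horner (a *: p) x = a *: op_horner p x.
Proof. by rewrite -[_ *: p]addr0 op_hornerPl op_horner0 addr0. Qed.

Lemma op_hornerC a x : op_horner a%:P x = a *: x.
Proof. by rewrite (@op_horner_widen 1) ?size_polyC_leq1 // big_ord1 coefC. Qed.

Lemma op_horner1 x : op_horner 1 x = x.
Proof. by rewrite op_hornerC scale1r. Qed.

Lemma op_hornerMX p x : op_horner (p * 'X) x = op_horner p (f x).
Proof.
rewrite (@op_horner_widen (size p).+1).
  rewrite big_ord_recl coefMX eqxx scale0r add0r; apply: eq_bigr => i _.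
  by rewrite coefMX /= -iterSr.
by have [->|p0] := eqVneq p 0; rewrite ?mul0r ?size_poly0 // size_mulX.
Qed.

Lemma op_horner_comm p x : op_horner p (f x) = f (op_horner p x).
Proof.
rewrite /op_horner linear_sum; apply: eq_bigr => i _.
by rewrite linearZ -iterSr.
Qed.

Lemma op_hornerM p q x : op_horner (p * q) x = op_horner p (op_horner q x).
Proof.
elim/poly_ind: p q x => [|p c IH] q x; first by rewrite mul0r !op_horner0.
rewrite mulrDl -mulrA [_ * q]mulrC mulrA mul_polyC !op_hornerD op_hornerZ.
rewrite !op_hornerMX op_hornerC IH; congr (op_horner _ _ + _).
exact: op_horner_comm.
Qed.

Lemma op_hornerX x : op_horner 'X x = f x.
Proof. by rewrite -['X]mul1r op_hornerMX op_horner1. Qed.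

Lemma op_hornerXaddC a x : op_horner ('X + a%:P) x = f x + a *: x.
Proof. by rewrite op_hornerD op_hornerX op_hornerC. Qed.

Lemma op_horner_exp p (g : V -> V) n x :
  op_horner p =1 g -> op_horner (p ^+ n) x = iter n g x.
Proof.
move=> pg; elim: n x => [|n IH] x; first exact: op_horner1.
by rewrite exprS op_hornerM IH pg.
Qed.

Lemma op_hornerMC p q x :
  op_horner p (op_horner q x) = op_horner q (op_horner p x).
Proof. by rewrite -!op_hornerM mulrC. Qed.

End OperatorPolynomial.

(** * Polynomials in a Rota-Baxter operator, applied to the identity element *)

Section RotaBaxterPolynomial.
Variables (F : fieldType) (A : algebra F) (e : A).
Variables (lam : F) (R : {linear A -> A}).
Hypotheses (unitA : is_identity e) (rbR : rota_baxter lam R).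
Implicit Types (p q h : {poly F}) (x y : A).

Local Notation act := (op_horner R).
Local Notation T := ('X + lam%:P : {poly F}).

(* With L the left multiplication by [R e], this is [L, R] = R (R + lam id):
   commutation with L acts on polynomials in R as X (X + lam) d/dX. *)
Lemma op_horner_derivation p x :
  R e ∙ act p x = act p (R e ∙ x) + act (p^`() * ('X * T)) x.
Proof.
elim/poly_ind: p x => [|p c IH] x.
  by rewrite deriv0 mul0r !op_horner0 linear0r add0r.
have -> : (p * 'X + c%:P)^`() * ('X * T)
    = (p^`() * ('X * T)) * 'X + p * ('X * T).
  by rewrite !derivE; ring.
rewrite !op_hornerD !op_hornerMX !op_hornerC linearDr linearZr /=.
rewrite IH -!addrA.
rewrite [c *: _ + _]addrC !addrA; congr (_ + _); rewrite addrAC; congr (_ + _).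
rewrite rbR op_hornerM [in RHS]op_hornerM op_hornerX op_hornerXaddC.
rewrite -!linearD; congr (act p (R _)).
by rewrite (unitA (R x)).1 (unitA x).1 addrA.
Qed.

Hypothesis charF : [pchar F] =i pred0.

Lemma natf_neq0_char0 n : n.+1%:R != 0 :> F.
Proof. by rewrite ((pcharf0P F).1 charF). Qed.

(** Multiplication by [R e] turns [p] into [p X + p' X (X + lam)], whose coefficient in degree k+1
    is k+1 times the leading coefficient of [p]. This is nonzero in characteristic zero, so the
    degree grows by exactly one. *)
Lemma apow_op_horner k :
  exists2 p : {poly F}, size p = k.+1 & apow e (R e) k = act p e.
Proof.
elim: k => [|k [p sp E]]; first by exists 1; rewrite ?size_poly1 ?op_horner1.
exists (p * 'X + p^`() * ('X * T)); last first.
  rewrite /apow iterS -/(apow e (R e) k) E op_horner_derivation op_hornerD.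
  by rewrite (unitA (R e)).2 op_hornerMX.
have qE i : (p * 'X + p^`() * ('X * T))`_i.+1
    = p`_i *+ i.+1 + (lam * p`_i.+1) *+ i.+1.
  have -> : p^`() * ('X * T) = p^`() * 'X * 'X + lam *: (p^`() * 'X).
    by rewrite -mul_polyC; ring.
  rewrite !coefD coefZ !coefMX /= addrA; congr (_ + _); last first.
    by rewrite coef_deriv mulrnAr.
  by case: i => [|i] /=; rewrite ?addr0 // coef_deriv -mulrS.
have pk : p`_k != 0.
  rewrite -[k]/(k.+1.-1) -sp -/(lead_coef p) lead_coef_eq0.
  by rewrite -size_poly_eq0 sp.
apply/eqP; rewrite eqn_leq; apply/andP; split.
  apply/leq_sizeP => -[|i] // ki.
  rewrite ltnS in ki; rewrite qE !(nth_default 0) ?sp ?leqW //.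
  by rewrite mulr0 !mul0rn addr0.
apply: coef_neq0_lt_size.
rewrite qE [in X in _ + X]nth_default ?sp // mulr0 mul0rn addr0.
by rewrite -mulr_natr mulf_neq0 // natf_neq0_char0.
Qed.

(** The powers of [R e] come from polynomials of distinct degrees, so a nontrivial relation between
    them gives a nonzero polynomial. *)
Lemma op_horner_annihilator :
  algebraic_elt e (R e) -> exists2 g : {poly F}, g != 0 & act g e = 0.
Proof.
move=> [p p0 pe].
(* Induction over truncations of the relation; the size bound ensures that a nonzero top term cannot
   cancel. *)
suff /(_ (size p)) [g gE [le_g coef_g]] : forall n, exists2 g : {poly F},
    act g e = \sum_(k < n) p`_k *: apow e (R e) k &
    (size g <= n)%N /\ (forall k, n = k.+1 -> p`_k != 0 -> g != 0).
  exists g; last by rewrite gE.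
  apply: (coef_g (size p).-1); first by rewrite prednK ?size_poly_gt0.
  by rewrite -/(lead_coef p) lead_coef_eq0.
elim=> [|n [g gE [le_g _]]].
  by exists 0; rewrite ?op_horner0 ?big_ord0 // size_poly0.
have [P sP PE] := apow_op_horner n.
exists (p`_n *: P + g).
  by rewrite op_hornerD op_hornerZ big_ord_recr gE PE addrC.
split=> [|_ [<-] pn].
  rewrite (leq_trans (size_polyD _ _)) // geq_max (leqW le_g) andbT -sP.
  exact: size_scale_leq.
by rewrite -size_poly_gt0 size_polyDl ?size_scale ?sP.
Qed.

(** For [g = X^i T^j h], the product [g' X T] is [X^(i+1) T^(j+1) h'] plus the multiple
    [(i T + j X) g] of [g], which kills [e]. *)
Lemma op_horner_deriv_step i j h :
    act ('X ^+ i * T ^+ j * h) e = 0 ->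
  act ('X ^+ i.+1 * T ^+ j.+1 * h^`()) e = 0.
Proof.
set g := 'X ^+ i * T ^+ j * h => ge.
(* As [R e ∙ e = R e], the term [act g (R e ∙ e)] is [R (act g e) = 0]; only [act (g' X T) e = 0]
   remains. *)
have := op_horner_derivation g e.
rewrite ge linear0r (unitA (R e)).2 op_horner_comm ge linear0 add0r => /esym.
have -> : g^`() * ('X * T) = 'X ^+ i.+1 * T ^+ j.+1 * h^`()
    + (T * i%:R + 'X * j%:R) * g.
  have XE : ('X ^+ i)^`() * 'X = 'X ^+ i * i%:R :> {poly F}.
    rewrite mulr_natr derivXn mulrnAl.
    by case: i {g ge} => // i; rewrite -exprSr.
  have TE : (T ^+ j)^`() * T = T ^+ j * j%:R.
    rewrite mulr_natr deriv_exp !derivE addr0 mul1r mulrnAl.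
    by case: j {g ge} => // j; rewrite -exprSr.
  (* Stated for arbitrary polynomials, with [XE] and [TE] as the two assumptions, so that no
     exponent i-1 or j-1 appears. *)
  have Leibniz (u v du dv x t dh a b : {poly F}) :
      du * x = u * a -> dv * t = v * b ->
    ((du * v + u * dv) * h + u * v * dh) * (x * t)
    = x * u * (t * v) * dh + (t * a + x * b) * (u * v * h).
    move=> xE tE.
    transitivity (du * x * (t * v * h) + dv * t * (x * u * h)
                  + x * u * (t * v) * dh); first by ring.
    by rewrite xE tE; ring.
  by rewrite /g !derivM !exprS; exact: Leibniz.
by rewrite op_hornerD [X in _ + X]op_hornerM ge linear0 addr0.
Qed.

(** In characteristic zero each derivative lowers the degree of [h] by exactly one, until a nonzero
    constant is left and can be divided out. *)
Lemma op_horner_unit_split h i j :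
    h != 0 -> act ('X ^+ i * T ^+ j * h) e = 0 ->
  exists i j, act ('X ^+ i * T ^+ j) e = 0.
Proof.
move: {2}(size h) (erefl (size h)) => n; elim: n h i j => [|n IH] h i j sh h0.
  by move: h0; rewrite -size_poly_eq0 sh.
case: n IH sh => [|n] IH sh hE.
  have /size_poly1P[c c0 hc] : size h == 1%N by rewrite sh.
  exists i, j; move: hE; rewrite hc mulrC mul_polyC op_hornerZ.
  by move/eqP; rewrite scaler_eq0 (negPf c0) => /eqP.
have hn : h^`()`_n != 0.
  rewrite coef_deriv -mulr_natr mulf_neq0 ?natf_neq0_char0 //.
  by rewrite -[n.+1]/(n.+2.-1) -sh -/(lead_coef h) lead_coef_eq0.
have sh' : size h^`() = n.+1.
  apply/eqP; rewrite eqn_leq; apply/andP; split.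
    by rewrite -ltnS -sh lt_size_deriv.
  exact: coef_neq0_lt_size.
apply: (IH h^`() i.+1 j.+1 sh').
  by rewrite -size_poly_eq0 sh'.
exact: op_horner_deriv_step.
Qed.

(** * Left multiplications sandwiched between polynomials in [R] *)

(** With [R y] in place of [y], the Rota-Baxter identity gives two terms; in one of them [R]
    commutes past [p] and the hypothesis applies. *)
Lemma sandwich_R p q x :
    (forall y, act p (R x ∙ act q y) = 0) ->
  forall y, act (p * 'X) (x ∙ act (T * q) y) = 0.
Proof.
move=> H y; have := H (R y).
rewrite op_horner_comm rbR op_hornerMX [act (T * q) y]op_hornerM op_hornerXaddC.
rewrite linearDr linearZr_LR /= -addrA linearD linearD /=.
by rewrite op_horner_comm H linear0 add0r.
Qed.

Lemma sandwich_T p q x :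
    (forall y, act p (act T x ∙ act q y) = 0) ->
  forall y, act (p * T) (x ∙ act ('X * q) y) = 0.
Proof.
have TR z : act T x ∙ R z = R (act T x ∙ z) + act T (x ∙ R z).
  rewrite !op_hornerXaddC !linearDl !linearZl_LR /= rbR.
  rewrite !linearD !linearZ /= addrA.
  by congr (_ + _); rewrite addrAC.
move=> H y; have := H (R y).
rewrite op_horner_comm TR linearD /= op_horner_comm H linear0 add0r.
by rewrite !op_hornerM op_hornerX.
Qed.

(** A factor [X] peeled off the left operand moves to the outer polynomial and leaves a [T] inside;
    a factor [T] leaves an [X]. This explains the swapped exponents. Once the operand is [e], its
    multiplication is the identity. *)
Lemma sandwich_monomial i j p q :
    (forall y, act p (act ('X ^+ i * T ^+ j) e ∙ act q y) = 0) ->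
  forall y, act (p * ('X ^+ i * T ^+ j) * ('X ^+ j * T ^+ i) * q) y = 0.
Proof.
elim: i p q => [|i IHi] p q H.
  rewrite !expr0 mul1r mulr1 in H *.
  elim: j p q H => [|j IHj] p q H y.
    rewrite !expr0 !mulr1 op_hornerM.
    by have := H y; rewrite expr0 op_horner1 (unitA _).1.
  have -> : p * T ^+ j.+1 * 'X ^+ j.+1 * q
      = p * T * T ^+ j * 'X ^+ j * ('X * q).
    by rewrite !exprS; ring.
  apply: IHj; apply: sandwich_T => z.
  by rewrite -op_hornerM -exprS.
have -> : p * ('X ^+ i.+1 * T ^+ j) * ('X ^+ j * T ^+ i.+1) * q
    = p * 'X * ('X ^+ i * T ^+ j) * ('X ^+ j * T ^+ i) * (T * q).
  by rewrite !exprS; ring.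
apply: IHi; apply: sandwich_R => z.
by rewrite -[R _]op_hornerX -op_hornerM mulrA -exprS.
Qed.

Lemma rota_baxter_algebraic :
  algebraic_elt e (R e) -> exists N, forall x, act ('X ^+ N * T ^+ N) x = 0.
Proof.
move=> /op_horner_annihilator[g g0 ge].
have [|i [j ij]] := @op_horner_unit_split g 0 0 g0.
  by rewrite !expr0 !mul1r.
(* The two monomials [X^i T^j] and [X^j T^i] multiply to [(X T)^(i+j)]. *)
exists (i + j)%N => x.
have := @sandwich_monomial i j 1 1 _ x; rewrite ij mul1r mulr1.
rewrite (_ : _ * _ = 'X ^+ (i + j) * T ^+ (i + j)); last first.
  by rewrite !exprD; ring.
by apply=> y; rewrite linear0l linear0.
Qed.

End RotaBaxterPolynomial.

(** * Elementwise algebraicity in both cases of the definition *)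

(** The first d+1 powers lie in the span of d vectors; a nonzero row in the left kernel of their
    coefficient matrix, read as a polynomial, annihilates [a]. *)
Lemma locally_finite_algebraic_elt (F : fieldType) (A : algebra F) (e a : A) :
  locally_finite A -> algebraic_elt e a.
Proof.
(* The powers start from [e], so [e] must be among the generators. *)
move=> /(_ [:: e; a])[d [b [_ span_b]]].
have gen k : generated [:: e; a] (apow e a k).
  elim: k => [|k IH]; first by apply: Gen_mem; rewrite mem_head.
  by apply: Gen_M IH; apply: Gen_mem; rewrite !inE eqxx orbT.
have [c cE] := fin_all_exists (fun k : 'I_d.+1 => span_b _ (gen k)).
pose C := \matrix_(k, i) c k i.
have /rowV0Pn[v /sub_kermxP vC v0] : kermx C != 0.
  by rewrite kermx_eq0 /row_free neq_ltn ltnS rank_leq_col.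
exists (rVpoly v).
  by apply: contraNneq v0 => v0; rewrite -[v]rVpolyK v0 linear0.
pose L : {linear A -> A} :=
  HB.pack (amul a) (GRing.isLinear.Build F A A *:%R (amul a) ((amulP A).2 a)).
rewrite -[LHS]/(op_horner L (rVpoly v) e).
rewrite (@op_horner_widen _ _ L d.+1) ?size_poly //.
transitivity (\sum_k \sum_i (v 0 k * C k i) *: b i).
  apply: eq_bigr => k _; rewrite coef_rVpoly_ord -/(apow e a k) cE scaler_sumr.
  by apply: eq_bigr => i _; rewrite scalerA mxE.
rewrite exchange_big big1 // => i _; rewrite -scaler_suml.
by have /matrixP/(_ 0 i) := vC; rewrite !mxE => ->; rewrite scale0r.
Qed.

Lemma algebraic_algebraic_elt (F : fieldType) (A : algebra F) (e a : A) :
  algebraic e -> algebraic_elt e a.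
Proof.
move=> [assoc nonassoc]; case: (classic (associative_alg A)) => [/assoc //|].
by move=> /nonassoc/locally_finite_algebraic_elt.
Qed.

(** * Isomorphisms of algebras *)

Section AlgebraIsomorphism.
Variable F : fieldType.
Implicit Types A B C : algebra F.

Lemma alg_iso_of A B (f : A -> B) :
  linear f -> bijective f -> {morph f : x y / x ∙ y} -> alg_iso A B.
Proof.
move=> lf bf mf.
pose f' : {linear A -> B} := HB.pack f (GRing.isLinear.Build F A B *:%R f lf).
by exists f'.
Qed.

Lemma alg_iso_sym A B : alg_iso A B -> alg_iso B A.
Proof.
move=> [f [[g fK gK] mf]]; apply: (alg_iso_of (f := g)).
- exact: can2_linear fK gK.
- by exists f.
- by move=> x y; apply: (canLR fK); rewrite mf !gK.
Qed.

Lemma alg_iso_trans A B C : alg_iso A B -> alg_iso B C -> alg_iso A C.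
Proof.
move=> [f [bf mf]] [g [bg mg]]; apply: (alg_iso_of (f := g \o f)).
- by move=> a x y /=; rewrite !linearP.
- exact: bij_comp.
- by move=> x y /=; rewrite mf mg.
Qed.

Lemma zero_product_iso A B : alg_iso A B -> zero_product B -> zero_product A.
Proof.
by move=> [f [bf mf]] B0 x y; apply: (bij_inj bf); rewrite mf B0 linear0.
Qed.

Lemma alg_iso_zero_product A (mu nu : A -> A -> A)
    (muP : bilinear_for *:%R *:%R mu) (nuP : bilinear_for *:%R *:%R nu) :
  (forall x y, mu x y = 0) -> (forall x y, nu x y = 0) ->
  alg_iso (Algebra muP) (Algebra nuP).
Proof.
move=> mu0 nu0; apply: (@alg_iso_of (Algebra muP) (Algebra nuP) id).
- by [].
- by exists id.
- by move=> x y; rewrite /= mu0 nu0.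
Qed.

End AlgebraIsomorphism.

(** * Stabilisation of the derived algebras *)

Section LimitingDerived.
Variables (F : fieldType) (A : algebra F) (lam : F) (R : {linear A -> A}).

Lemma limiting_index_exists N :
    (forall n, (N <= n)%N ->
       alg_iso (derived_alg lam R n) (derived_alg lam R N)) ->
  exists m, limiting_index lam R m /\
    alg_iso (derived_alg lam R m) (derived_alg lam R N).
Proof.
move=> isoN.
have [m [mS min_m]] : exists m, limiting_index lam R m.
  have : stable_from lam R N by move=> n /ltnW/isoN.
  elim/ltn_ind: N {isoN} => N IH NS.
  have [[k kN kS]|no] := classic (exists2 k, (k < N)%N & stable_from lam R k).
    exact: IH kN kS.
  exists N; split=> // k kS; rewrite leqNgt.
  by apply/negP => kN; case: no; exists k.
exists m; split=> //.
(* [stable_from] only concerns indices strictly above [m], so the comparison passes through an index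
   beyond both [m] and [N]. *)
apply: (@alg_iso_trans _ _ (derived_alg lam R (maxn m N).+1)).
  by apply/alg_iso_sym/mS; rewrite ltnS leq_maxl.
by apply: isoN; rewrite leqW ?leq_maxr.
Qed.

(** At weight zero the m-th product is a combination of terms [R^s x ∙ R^t y] with s + t = m, and s
    or t is at least [N]. *)
Lemma derived_mul_nilpotent N m :
    lam = 0 -> (forall x, iter N R x = 0) -> (N + N <= m)%N ->
  forall x y, derived_mul lam R m x y = 0.
Proof.
move=> lam0 RN le_m x y.
have d0l k z : derived_mul lam R k 0 z = 0.
  exact: (linear0l (@amul _ (derived_alg lam R k)) z).
have d0r k z : derived_mul lam R k z 0 = 0.
  exact: (linear0r (@amul _ (derived_alg lam R k)) z).
(* Unfolding one product lowers [m] and one of i, j by one; the bound m+1 forces i or j to be 0 when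
   m = 0. *)
suff: forall i j, (i + j <= m.+1)%N -> iter i R x = 0 -> iter j R y = 0 ->
    derived_mul lam R m x y = 0.
  by move=> /(_ N N (leqW le_m) (RN x) (RN y)).
elim: m {le_m} x y => [|m IH] x y [|i] [|j] //= le_ij xi yj; subst;
  rewrite ?linear0l ?linear0r ?linear0 ?d0l ?d0r ?scale0r ?scaler0 ?addr0 //.
  by rewrite addnS in le_ij.
rewrite (IH (R x) y i j.+1) -?iterSr // (IH x (R y) i.+1 j) -?iterSr ?addr0 //.
by rewrite addSnnS.
Qed.

Variables (rbR : rota_baxter lam R) (lam0 : lam != 0).
Local Notation act := (op_horner R).
Local Notation T := ('X + lam%:P : {poly F}).

Lemma iter_op_horner n x : iter n R x = act ('X ^+ n) x.
Proof. by rewrite (op_horner_exp (g := R)) // => y; rewrite op_hornerX. Qed.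

Lemma iter_shift_op_horner n x : iter n (shift_op lam R) x = act (T ^+ n) x.
Proof.
rewrite (op_horner_exp (g := shift_op lam R)) // => y.
by rewrite op_hornerXaddC.
Qed.

Lemma derived_mul_iter (f : {linear A -> A}) :
    (forall i x y,
       f (derived_mul lam R i.+1 x y) = derived_mul lam R i (f x) (f y)) ->
  forall n x y, iter n f (derived_mul lam R n x y) = iter n f x ∙ iter n f y.
Proof. by move=> fM; elim=> // n IH x y; rewrite iterSr fM IH -!iterSr. Qed.

Lemma coprime_shift m n : coprimep ('X ^+ m) (T ^+ n).
Proof.
apply/coprimep_expl/coprimep_expr; rewrite coprimep_sym.
by have := coprimep_XsubC ('X + lam%:P) 0; rewrite subr0 /root !hornerE => ->.
Qed.

Lemma op_horner_coprime_eq0 p q x :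
  coprimep p q -> act p x = 0 -> act q x = 0 -> x = 0.
Proof.
move=> /Bezout_eq1_coprimepP[[u v] /= uv] px qx.
by rewrite -[x](op_horner1 R) -uv op_hornerD !op_hornerM px qx !linear0 addr0.
Qed.

(** The exponent [k] is independent of [n]: a single target for all [n] makes the derived algebras
    isomorphic to one another. *)
Lemma derived_alg_iso_kernels N n k :
    (forall x, act ('X ^+ N * T ^+ N) x = 0) -> (N <= n)%N -> (N <= k)%N ->
  alg_iso (derived_alg lam R n)
          (dsum (kerR_alg rbR lam0 k) (kerRlam_alg rbR lam0 k)).
Proof.
move=> XT0 Nn Nk.
have XT i j x : (N <= i)%N -> (N <= j)%N -> act ('X ^+ i * T ^+ j) x = 0.
  move=> Ni Nj; rewrite -(subnK Ni) -(subnK Nj) !exprD mulrACA op_hornerM.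
  by rewrite XT0 linear0.
(* The kernels are stable from [N] on: [X^n x] is killed by the coprime [X^k] and [T^n], hence is
   zero. *)
have kerX x : act ('X ^+ k) x = 0 -> act ('X ^+ n) x = 0.
  move=> xk; apply: (op_horner_coprime_eq0 (coprime_shift k n)).
    by rewrite op_hornerMC xk linear0.
  by rewrite -op_hornerM mulrC XT.
have kerT x : act (T ^+ k) x = 0 -> act (T ^+ n) x = 0.
  move=> xk; apply: (op_horner_coprime_eq0 (coprime_shift n k)).
    by rewrite -op_hornerM XT.
  by rewrite op_hornerMC xk linear0.
have f1P x : act (T ^+ n) x \in iker R k.
  by rewrite inE iter_op_horner -op_hornerM XT.
have f2P x : act ('X ^+ n) x \in iker (shift_op lam R) k.
  by rewrite inE iter_shift_op_horner -op_hornerM mulrC XT.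
pose f (x : derived_alg lam R n) :
    dsum (kerR_alg rbR lam0 k) (kerRlam_alg rbR lam0 k) :=
  (Sub (act (T ^+ n) x) (f1P x), Sub (act ('X ^+ n) x) (f2P x)).
have /Bezout_eq1_coprimepP[[u v] /= uv] := coprime_shift n n.
have uvE x : act (u * 'X ^+ n) x + act (v * T ^+ n) x = x.
  by rewrite -op_hornerD uv op_horner1.
apply: (alg_iso_of (f := f)).
- move=> a x y; congr pair; apply: val_inj => /=; exact: op_hornerPr.
(* The inverse comes from the Bezout relation [u X^n + v T^n = 1]: [v T^n] is the identity on the
   kernel of [X^n], and [u X^n] on that of [T^n]. *)
- exists (fun z => act v (val z.1) + act u (val z.2)).
    by move=> x /=; rewrite -!op_hornerM addrC uvE.
  move=> [[y yk] [z zk]] /=.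
  have yn : act ('X ^+ n) y = 0.
    by apply: kerX; rewrite -iter_op_horner; apply/eqP.
  have zn : act (T ^+ n) z = 0.
    by apply: kerT; rewrite -iter_shift_op_horner; apply/eqP.
  have := uvE y; have := uvE z.
  rewrite !op_hornerM yn zn !linear0 addr0 add0r => uz vy.
  congr pair; apply: val_inj => /=; rewrite linearD /=.
    by rewrite [X in _ + X]op_hornerMC zn linear0 addr0 op_hornerMC.
  by rewrite op_hornerMC yn linear0 add0r op_hornerMC.
- move=> x y; congr pair; apply: val_inj => /=.
    by rewrite -!iter_shift_op_horner derived_mul_iter //; exact: shift_derived.
  by rewrite -!iter_op_horner derived_mul_iter //; exact: rb_derived.
Qed.

End LimitingDerived.

Theorem proposition6 (F : fieldType) (charF : [pchar F] =i pred0)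
    (A : algebra F) (e : A) (unitA : is_identity e) (algA : algebraic e)
    (lam : F) (R : {linear A -> A}) (rbR : rota_baxter lam R) :
  exists m : nat,
    limiting_index lam R m /\
    (lam = 0 -> zero_product (derived_alg lam R m)) /\
    (forall lam0 : lam != 0,
       exists N : nat, forall n : nat, (N <= n)%N ->
         alg_iso (derived_alg lam R m)
                 (dsum (kerR_alg rbR lam0 n) (kerRlam_alg rbR lam0 n))).
Proof.
have algRe := algebraic_algebraic_elt (R e) algA.
have [N RN] := rota_baxter_algebraic unitA rbR charF algRe.
have [lam0|lam0] : lam = 0 \/ lam != 0 by case: (eqVneq lam 0); [left|right].
  (* At weight zero [X + lam] is [X], so [X^N T^N] is [X^(2N)]. *)
  have R0 x : iter (N + N) R x = 0.
    by rewrite iter_op_horner exprD; move: (RN x); rewrite lam0 addr0.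
  have M0 := derived_mul_nilpotent lam0 R0.
  have [|m [mL mN]] := @limiting_index_exists _ _ lam R (N + N + (N + N)).
    move=> n le_n; apply: alg_iso_zero_product; exact: M0.
  exists m; split=> //; split=> [_|]; last first.
    by move=> lam_neq0; case/eqP: lam_neq0.
  by apply: zero_product_iso mN _; apply: M0.
have isoK := derived_alg_iso_kernels rbR lam0 RN.
have [|m [mL mN]] := @limiting_index_exists _ _ lam R N.
  move=> n le_n; apply: alg_iso_trans (isoK n N le_n (leqnn N)) _.
  exact/alg_iso_sym/isoK.
exists m; split=> //; split=> [l0|lam0'].
  by move: (lam0); rewrite l0 eqxx.
(* The kernel algebras carry a proof of [lam != 0], and any two such proofs are equal. *)
exists N => n le_n; rewrite (bool_irrelevance lam0' lam0).
exact: alg_iso_trans mN (isoK _ _ _ _).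
Qed.
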